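(* Let $\mathbf{A}\in\mathbb{R}^{n\times n}$ be symmetric positive semidefinite, let $f\in\mathscr{F}$ and let $1\le k\le n$. Then the FlexTrace estimator $$\widehat{\mathrm{tr}}_{\mathrm{FT}}=\frac1k\sum_{i=1}^k\left(\operatorname{tr} f(\widehat{\mathbf{A}}_{-i})+\boldsymbol{\omega}_i^\top\big(f(\widehat{\mathbf{A}}_{\mathrm{nys}})-f(\widehat{\mathbf{A}}_{-i})\big)\boldsymbol{\omega}_i\right),$$ regarded as a function of $(\boldsymbol{\omega}_1,\dots,\boldsymbol{\omega}_k)\in(\mathbb{R}^n)^k$, is exchangeable.
   Context: $\mathscr{F}$ is the set of functions $f:[0,\infty)\to[0,\infty)$ with $f(0)=0$ that are operator monotone, i.e. $\mathbf{C}\preceq\mathbf{D}$ implies $f(\mathbf{C})\preceq f(\mathbf{D})$ for symmetric positive semidefinite matrices, where $\preceq$ is the Loewner order. For symmetric positive semidefinite $\mathbf{M}=\mathbf{U}\operatorname{diag}(\mu_i)\mathbf{U}^\top$, $f(\mathbf{M})=\mathbf{U}\operatorname{diag}(f(\mu_i))\mathbf{U}^\top$. $\boldsymbol{\Omega}\in\mathbb{R}^{n\times k}$ is the matrix with columns $\boldsymbol{\omega}_1,\dots,\boldsymbol{\omega}_k$ (in the estimator these are independent $\mathcal{N}(\mathbf{0},\mathbf{I})$ vectors). The Nyström approximation of $\mathbf{A}$ with test matrix $\boldsymbol{\Omega}$ is $\widehat{\mathbf{A}}_{\mathrm{nys}}=\mathbf{A}\boldsymbol{\Omega}(\boldsymbol{\Omega}^\top\mathbf{A}\boldsymbol{\Omega})^\dagger(\mathbf{A}\boldsymbol{\Omega})^\top$,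 with $\dagger$ the Moore–Penrose pseudoinverse. $\widehat{\mathbf{A}}_{-i}$ is the Nyström approximation of $\mathbf{A}$ whose test matrix is $\boldsymbol{\Omega}$ with its $i$-th column removed (an empty test matrix gives the zero matrix). A measurable function $Q:(\mathbb{R}^n)^k\to\mathbb{R}$ is exchangeable if $Q(\boldsymbol{\omega}_1,\dots,\boldsymbol{\omega}_k)=Q(\boldsymbol{\omega}_{\sigma(1)},\dots,\boldsymbol{\omega}_{\sigma(k)})$ for every permutation $\sigma\in S_k$ and every $(\boldsymbol{\omega}_1,\dots,\boldsymbol{\omega}_k)\in(\mathbb{R}^n)^k$. *)

(* Defs.v *)
From HB Require Import structures.
From mathcomp Require Import all_boot all_order all_algebra all_fingroup.
From mathcomp Require Import all_classical all_reals all_analysis.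

Set Implicit Arguments.
Unset Strict Implicit.
Unset Printing Implicit Defensive.

Import Order.TTheory GRing.Theory Num.Theory.

Local Open Scope classical_set_scope.
Local Open Scope ring_scope.

Definition psdmx (R : realType) (n : nat) (M : 'M[R]_n) : Prop :=
  M^T = M /\ forall x : 'cV[R]_n, 0 <= (x^T *m M *m x) 0 0.

Definition loewner_le (R : realType) (n : nat) (C D : 'M[R]_n) : Prop :=
  psdmx (D - C).

Definition orthogonal_mx (R : realType) (n : nat) (U : 'M[R]_n) : Prop :=
  U^T *m U = 1%:M.

(* The set below is a singleton when M is symmetric: the result does not depend
   on the orthogonal diagonalization of M.  The default value 0 is only
   returned when M is not symmetric. *)
Definition matfun (R : realType) (f : R -> R) (n : nat) (M : 'M[R]_n) :
    'M[R]_n :=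
  xget 0 [set N | exists (U : 'M[R]_n) (mu : 'rV[R]_n),
    [/\ orthogonal_mx U,
        M = U *m diag_mx mu *m U^T &
        N = U *m diag_mx (map_mx f mu) *m U^T]].

(* A function from [0, +oo[ to itself is represented by a total f : R -> R whose
   values at negative arguments are unconstrained; they are never used, as
   matfun f is only applied to positive semidefinite matrices. *)
Definition opmonotone (R : realType) (f : R -> R) : Prop :=
  [/\ forall x, 0 <= x -> 0 <= f x,
      f 0 = 0 &
      forall (m : nat) (C D : 'M[R]_m), psdmx C -> psdmx D ->
        loewner_le C D -> loewner_le (matfun f C) (matfun f D)].

Definition penrose (R : realType) (m n : nat)
    (M : 'M[R]_(m, n)) (X : 'M[R]_(n, m)) : Prop :=
  [/\ M *m X *m M = M, X *m M *m X = X,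
      (M *m X)^T = M *m X & (X *m M)^T = X *m M].

(* The Moore-Penrose pseudoinverse, i.e. the unique X such that penrose M X; it
   differs in general from pinvmx. *)
Definition mpinvmx (R : realType) (m n : nat) (M : 'M[R]_(m, n)) :
    'M[R]_(n, m) :=
  xget 0 [set X | penrose M X].

Definition nystrom (R : realType) (n k : nat)
    (A : 'M[R]_n) (Omega : 'M[R]_(n, k)) : 'M[R]_n :=
  A *m Omega *m mpinvmx (Omega^T *m A *m Omega) *m (A *m Omega)^T.

(* (R^n)^k is the type k.-tuple (n.-tuple R), which carries the product of the
   Borel sigma-algebras of R. *)
Definition colsmx (R : realType) (n k : nat) (w : k.-tuple (n.-tuple R)) :
    'M[R]_(n, k) :=
  \matrix_(i < n, j < k) tnth (tnth w j) i.

Definition flextrace (R : realType) (n k : nat) (A : 'M[R]_n) (f : R -> R)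
    (w : k.-tuple (n.-tuple R)) : R :=
  let Omega := colsmx w in
  let Anys := nystrom A Omega in
  let Aloo (i : 'I_k) := nystrom A (col' i Omega) in
  k%:R^-1 * \sum_(i < k)
    (\tr (matfun f (Aloo i)) +
     ((col i Omega)^T *m (matfun f Anys - matfun f (Aloo i)) *m col i Omega)
       0 0).

Definition exchangeable (R : realType) (n k : nat)
    (Q : k.-tuple (n.-tuple R) -> R) : Prop :=
  measurable_fun setT Q /\
  forall (s : 'S_k) (w : k.-tuple (n.-tuple R)),
    Q w = Q [tuple tnth w (s i) | i < k].

(* Main.v *)
(** Exchangeability has two halves.  Invariance: permuting the columns of the
    test matrix multiplies it on the right by an orthogonal [P], which conjugates
    the (unique) pseudoinverse by [P] and leaves the Nystrom approximation
    unchanged; removing column [i] after permuting by [s] is, up to a permutation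
    of the remaining columns, removing column [s i], so the sum is reindexed.
    Measurability: for a measurable symmetric matrix [M w], the functions [g]
    such that [w |-> g (M w)] is measurable contain the identity and are closed
    under sums, products, inverses and pointwise limits; rational functions
    converging pointwise to indicators of rays put all Borel functions in this
    class.  It then applies to [x |-> x^-1], which computes the pseudoinverse
    because [0^-1 = 0], and to [f], which is nondecreasing on [0, +oo[ (use
    1x1 matrices) though possibly discontinuous at 0. *)

Require Import Defs.
From HB Require Import structures.
From mathcomp Require Import all_boot all_order all_algebra all_fingroup.
From mathcomp Require Import all_classical all_reals all_analysis.
From mathcomp Require Import measurable_realfun complex ring lra.

Set Implicit Arguments.
Unset Strict Implicit.
Unset Printing Implicit Defensive.

Import Order.TTheory GRing.Theory Num.Theory.
Import numFieldNormedType.Exports HBSimple.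

Local Open Scope classical_set_scope.
Local Open Scope ring_scope.

(** * Real spectral theorem and the functional calculus of symmetric matrices *)

Section linear_algebra.
Variable R : realType.

Lemma trmx_mul_self_ge0 n (x : 'cV[R]_n) : 0 <= (x^T *m x) 0 0.
Proof. by rewrite mxE sumr_ge0// => i _; rewrite mxE -expr2 sqr_ge0. Qed.

Lemma trmx_mul_self_eq0 n (x : 'cV[R]_n) : ((x^T *m x) 0 0 == 0) = (x == 0).
Proof.
apply/eqP/eqP => [|->]; last by rewrite mulmx0 mxE.
rewrite mxE => /psumr_eq0P => x0; apply/colP => i.
have /x0 : forall i, true -> 0 <= x^T 0 i * x i 0.
  by move=> j _; rewrite mxE -expr2 sqr_ge0.
by move=> /(_ i isT); rewrite !mxE -expr2 => /eqP; rewrite sqrf_eq0 => /eqP.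
Qed.

(* Householder reflection along [u]; it is the identity for [u = 0]. *)
Definition reflection n (u : 'cV[R]_n) : 'M[R]_n :=
  1%:M - (2 / (u^T *m u) 0 0) *: (u *m u^T).

Lemma trmx_reflection n (u : 'cV[R]_n) : (reflection u)^T = reflection u.
Proof. by rewrite linearB linearZ /= trmx1 trmx_mul trmxK. Qed.

Lemma reflectionK n (u : 'cV[R]_n) : reflection u *m reflection u = 1%:M.
Proof.
have [->|u0] := eqVneq u 0.
  by rewrite /reflection mul0mx scaler0 subr0 mulmx1.
have := u0; rewrite -trmx_mul_self_eq0 /reflection; set q := (_ *m _) 0 0 => q0.
have PP : u *m u^T *m (u *m u^T) = q *: (u *m u^T).
  rewrite mulmxA -(mulmxA u) [u^T *m u]mx11_scalar -/q mul_mx_scalar.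
  by rewrite -scalemxAl.
rewrite mulmxBl mul1mx mulmxBr mulmx1 -scalemxAl -scalemxAr PP !scalerA.
rewrite -[RHS]subr0 -addrA; congr (_ + _).
rewrite -opprD; congr (- _); rewrite -scalerBl -scalerDl.
rewrite (_ : _ + _ = 0) ?scale0r//.
by field.
Qed.

(** With [s] the inner product of the unit vectors, [x - y] has squared norm [2 * (1 - s)] and inner
    product [1 - s] with [x], so the reflection subtracts exactly [x - y] from [x]. It serves to
    move an eigenvector onto the first basis vector. *)
Lemma reflection_sub n (x y : 'cV[R]_n) :
  x^T *m x = 1%:M -> y^T *m y = 1%:M -> reflection (x - y) *m x = y.
Proof.
move=> x1 y1; have [->|xy] := eqVneq x y.
  by rewrite subrr /reflection mul0mx scaler0 subr0 mul1mx.
have [s xyE] : exists s, x^T *m y = s%:M by eexists; exact: mx11_scalar.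
have trB : (x - y)^T = x^T - y^T by rewrite linearB.
have yxE : y^T *m x = s%:M.
  by rewrite -[LHS]trmxK trmx_mul trmxK xyE tr_scalar_mx.
have := xy; rewrite -subr_eq0 -trmx_mul_self_eq0 /reflection.
have E : (x - y)^T *m (x - y) = (2 * (1 - s))%:M.
  rewrite trB mulmxBl !mulmxBr x1 y1 xyE yxE -!raddfB /=.
  by congr (_%:M); ring.
rewrite E mxE eqxx mulr1n mulf_eq0 => /norP[_ s1].
rewrite mulmxBl mul1mx -scalemxAl -mulmxA trB [(x^T - y^T) *m x]mulmxBl x1 yxE.
rewrite -raddfB mul_mx_scalar scalerA.
rewrite (_ : _ * _ = 1) ?scale1r ?subKr//.
by field.
Qed.


Lemma trmx_mul_self_gt0 n (x : 'cV[R]_n) : x != 0 -> 0 < (x^T *m x) 0 0.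
Proof. by move=> x0; rewrite lt_def trmx_mul_self_eq0 x0 trmx_mul_self_ge0. Qed.

(** The complexified matrix is Hermitian, so the complex spectral theorem provides a real
    eigenvalue. Being a root of the characteristic polynomial, which has real coefficients, it is an
    eigenvalue over [R]; the left eigenvector is then transposed, by symmetry, and normalized. *)
Lemma symmetric_eigenvector n (A : 'M[R]_n.+1) : A^T = A ->
  exists (a : R) (x : 'cV[R]_n.+1), x^T *m x = 1%:M /\ A *m x = a *: x.
Proof.
move=> symA; pose B : 'M[R[i]]_n.+1 := map_mx (real_complex R) A.
have BH : B \is hermsymmx.
  apply: realsym_hermsym.
    apply/is_hermitianmxP; rewrite expr0 scale1r; apply/matrixP => i j.
    by rewrite !mxE -[in LHS]symA mxE.
  by apply/mxOverP => i j; apply/complex_realP; exists (A i j); rewrite mxE.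
have /mxOverP/(_ 0 0)/complex_realP[a Da] := hermitian_spectral_diag_real BH.
have /orthomx_spectralP BE := hermitian_normalmx BH.
have Bc : eigenvalue B a%:C%C.
  apply/eigenvalueP; exists (row 0 (spectralmx B)).
    rewrite -row_mul [X in _ *m X]BE !mulmxA mulmxV ?spectral_unit// mul1mx.
    by rewrite row_mul row_diag_mx -scalemxAl -rowE Da.
  apply: contraTneq (spectral_unit B) => P0.
  rewrite unitmxE (expand_det_row _ 0) big1 ?unitr0// => j _.
  by move/rowP/(_ j): P0; rewrite !mxE => ->; rewrite mul0r.
have : eigenvalue A a.
  by move: Bc; rewrite !eigenvalue_root_char -map_char_poly fmorph_root.
move=> /eigenvalueP[v vA v0].
have q0 : 0 < (v *m v^T) 0 0.
  by rewrite -{1}[v]trmxK trmx_mul_self_gt0// trmx_eq0.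
have [q vq] : exists q, v *m v^T = q%:M by eexists; exact: mx11_scalar.
move: q0; rewrite vq mxE eqxx mulr1n => q0.
exists a, ((Num.sqrt q)^-1 *: v^T); split.
  have -> : ((Num.sqrt q)^-1 *: v^T)^T = (Num.sqrt q)^-1 *: v.
    by rewrite linearZ /= trmxK.
  rewrite -scalemxAl -scalemxAr scalerA vq scale_scalar_mx -invfM -expr2.
  by rewrite sqr_sqrtr ?ltW// mulVf// gt_eqF.
rewrite -{1}symA -scalemxAr -trmx_mul vA [(a *: v)^T]linearZ /=.
by rewrite !scalerA mulrC.
Qed.

Lemma orthogonal_mxC n (U : 'M[R]_n) : orthogonal_mx U -> U *m U^T = 1%:M.
Proof. exact: mulmx1C. Qed.

(** Induction by deflation: a reflection [H] exchanges a unit eigenvector with the first basis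
    vector [e], so [H *m A *m H] is symmetric with eigenvector [e], hence block diagonal, and the
    induction hypothesis treats the lower block. *)
Lemma symmetric_diagonalization n (A : 'M[R]_n) : A^T = A ->
  exists (U : 'M[R]_n) (mu : 'rV[R]_n),
    orthogonal_mx U /\ A = U *m diag_mx mu *m U^T.
Proof.
elim: n A => [A _|n IHn A symA].
  by exists 1%:M, 0; split; apply/matrixP => -[].
have [a [x [x1 Ax]]] := symmetric_eigenvector symA.
pose e : 'cV[R]_(1 + n) := col_mx 1%:M 0.
have e1 : e^T *m e = 1%:M.
  by rewrite tr_col_mx mul_row_col trmx1 trmx0 mulmx0 addr0 mulmx1.
pose H : 'M[R]_(1 + n) := reflection (x - e).
have Hx : H *m x = e by exact: reflection_sub.
have He : H *m e = x by rewrite -Hx mulmxA reflectionK mul1mx.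
have HT : H^T = H := trmx_reflection _.
pose B : 'M[R]_(1 + n) := H *m A *m H.
have BT : B^T = B by rewrite !trmx_mul HT symA mulmxA.
have Be : B *m e = a *: e by rewrite -!mulmxA He Ax -scalemxAr Hx.
have := Be; rewrite -[B]submxK /e mul_block_col !mulmx1 !mulmx0 !addr0.
rewrite scale_col_mx scaler0 => /eq_col_mx[Bul Bdl].
have Bur : ursubmx B = 0 by rewrite -[B]BT -trmx_dlsub Bdl trmx0.
have [V [mu [oV Bdr]]] : exists (V : 'M[R]_n) (mu : 'rV[R]_n),
    orthogonal_mx V /\ drsubmx B = V *m diag_mx mu *m V^T.
  by apply: IHn; rewrite trmx_drsub BT.
pose W : 'M[R]_(1 + n) := block_mx 1%:M 0 0 V.
pose D : 'rV[R]_(1 + n) := row_mx (a%:M : 'M[R]_1) mu.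
have oW : W^T *m W = 1%:M.
  rewrite /W tr_block_mx !trmx0 trmx1 mulmx_block !mulmx0 !mul0mx !addr0 !add0r.
  by rewrite oV mulmx1 -scalar_mx_block.
have BE : B = W *m diag_mx D *m W^T.
  rewrite /W diag_mx_row tr_block_mx !trmx0 trmx1 !mulmx_block.
  rewrite !mulmx0 !mul0mx !addr0 !add0r !mul0mx !mul1mx !mulmx1 -Bdr.
  rewrite -[LHS]submxK Bul Bdl Bur; congr block_mx.
  by apply/matrixP => i j; rewrite !ord1 !mxE eqxx/= mulr1n mulr1.
exists (H *m W), D; split.
  by rewrite /orthogonal_mx trmx_mul HT -mulmxA (mulmxA H) reflectionK mul1mx.
have -> : A = H *m B *m H.
  by rewrite !mulmxA reflectionK mul1mx -mulmxA reflectionK mulmx1.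
by rewrite BE trmx_mul HT !mulmxA.
Qed.

(** For a second diagonalization [V], [nu], the matrix [W = V^T *m U] intertwines the two diagonals:
    each entry [W i j] is zero unless [mu 0 j = nu 0 i]. Hence [W] also intertwines their images
    under [f]. *)
Lemma matfunE (f : R -> R) n (U : 'M[R]_n) (mu : 'rV[R]_n) :
  orthogonal_mx U ->
  matfun f (U *m diag_mx mu *m U^T) = U *m diag_mx (map_mx f mu) *m U^T.
Proof.
move=> oU; apply: xget_unique => [|N [V [nu [oV UV ->]]]].
  by exists U, mu.
pose W := V^T *m U.
have WE : W *m diag_mx mu = diag_mx nu *m W.
  rewrite -[LHS]mulmx1 -oU mulmxA /W -(mulmxA V^T) -(mulmxA V^T) UV.
  by rewrite !mulmxA oV mul1mx.
have WfE : W *m diag_mx (map_mx f mu) = diag_mx (map_mx f nu) *m W.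
  apply/matrixP => i j; move/matrixP/(_ i j): WE.
  rewrite !mul_mx_diag !mul_diag_mx !mxE mulrC => /eqP.
  rewrite -subr_eq0 -mulrBl mulf_eq0 subr_eq0 => /orP[/eqP->|/eqP->].
    by rewrite mulrC.
  by rewrite mul0r mulr0.
have VW : V *m W = U by rewrite /W mulmxA orthogonal_mxC// mul1mx.
have -> : V^T = W *m U^T by rewrite /W -mulmxA orthogonal_mxC// mulmx1.
by rewrite mulmxA -(mulmxA V) -WfE mulmxA VW.
Qed.

End linear_algebra.

(** * Algebra of the functional calculus, and the pseudoinverse as an instance of it *)

Section matfun_theory.
Variable R : realType.

(** One pair [U], [mu] serves every [f], which reduces identities between values of [matfun] to
    scalar identities. *)
Lemma matfun_diagonalization n (M : 'M[R]_n) : M^T = M ->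
  exists (U : 'M[R]_n) (mu : 'rV[R]_n),
  [/\ orthogonal_mx U, M = U *m diag_mx mu *m U^T &
      forall f, matfun f M = U *m diag_mx (map_mx f mu) *m U^T].
Proof.
move=> /symmetric_diagonalization[U [mu [oU ->]]]; exists U, mu; split=> // f.
exact: matfunE.
Qed.

Lemma matfun_id n (M : 'M[R]_n) : M^T = M -> matfun id M = M.
Proof.
by move=> /matfun_diagonalization[U [mu [_ ME ->]]]; rewrite map_mx_id.
Qed.

Lemma matfun_cst n (M : 'M[R]_n) c : M^T = M -> matfun (fun=> c) M = c%:M.
Proof.
move=> /matfun_diagonalization[U [mu [oU _ ->]]].
have -> : diag_mx (map_mx (fun=> c) mu) = c%:M.
  by rewrite -diag_const_mx; congr diag_mx; apply/rowP => i; rewrite !mxE.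
by rewrite mul_mx_scalar -scalemxAl orthogonal_mxC// scalemx1.
Qed.

Lemma matfunD n (M : 'M[R]_n) f g : M^T = M ->
  matfun (fun x => f x + g x) M = matfun f M + matfun g M.
Proof.
move=> /matfun_diagonalization[U [mu [_ _ E]]]; rewrite !E -mulmxDl -mulmxDr.
by congr (_ *m _ *m _); apply/matrixP => i j; rewrite !mxE mulrnDl.
Qed.

Lemma matfunM n (M : 'M[R]_n) f g : M^T = M ->
  matfun (fun x => f x * g x) M = matfun f M *m matfun g M.
Proof.
move=> /matfun_diagonalization[U [mu [oU _ E]]]; rewrite !E.
rewrite -!mulmxA; congr (_ *m _); rewrite !mulmxA -(mulmxA _ U^T) oU mulmx1.
congr (_ *m _); rewrite mulmx_diag; congr diag_mx; apply/rowP => i.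
by rewrite !mxE.
Qed.

Lemma matfunV n (M : 'M[R]_n) f : M^T = M -> (forall x, f x != 0) ->
  matfun (fun x => (f x)^-1) M = invmx (matfun f M).
Proof.
move=> symM f0.
have VM : matfun (fun x => (f x)^-1) M *m matfun f M = 1%:M.
  rewrite -matfunM// -(matfun_cst 1 symM); congr (matfun _ M).
  by apply/funext => x; rewrite mulVf.
have fU : matfun f M \in unitmx by case: (mulmx1_unit VM).
by rewrite -[LHS]mulmx1 -(mulmxV fU) mulmxA VM mul1mx.
Qed.

Lemma matfun_cvg n (M : 'M[R]_n) (h : (R -> R)^nat) f (i j : 'I_n) : M^T = M ->
  (forall x, h ^~ x @ \oo --> f x) ->
  (fun m => matfun (h m) M i j) @ \oo --> matfun f M i j.
Proof.
move=> /matfun_diagonalization[U [mu [_ _ E]]] hf.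
have entry g : matfun g M i j = \sum_k U i k * g (mu 0 k) * U j k.
  by rewrite E mul_mx_diag mxE; apply: eq_bigr => k _; rewrite !mxE.
rewrite entry; under eq_fun do rewrite entry.
apply: cvg_big => [|k _]; first exact: add_continuous.
by apply: cvgMr_tmp; apply: cvgMl_tmp; exact: hf.
Qed.

Lemma psdmx_matfun_eq n (M : 'M[R]_n) f g : psdmx M ->
  {in Num.nneg, f =1 g} -> matfun f M = matfun g M.
Proof.
move=> [symM M0] fg; have [U [mu [oU ME E]]] := matfun_diagonalization symM.
rewrite !E; congr (_ *m _ *m _); congr diag_mx; apply/rowP => k; rewrite !mxE.
(* The quadratic form of [M] at the [k]-th column of [U] is the [k]-th eigenvalue, which is
   therefore nonnegative. *)
apply: fg; rewrite nnegrE; have := M0 (col k U).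
rewrite ME colE trmx_mul !mulmxA -(mulmxA _ U^T) oU mulmx1 -(mulmxA _ U^T) oU.
by rewrite mulmx1 trmx_delta -rowE -colE !mxE eqxx.
Qed.

(** Transposing [M *m Y *m M *m X = M *m X] swaps the two symmetric factors and gives
    [M *m X = M *m Y]; likewise on the other side. Then [X = X *m M *m X] turns into [Y]. *)
Lemma penrose_unique m n (M : 'M[R]_(m, n)) X Y :
  penrose M X -> penrose M Y -> X = Y.
Proof.
move=> [MXM XMX MX XM] [MYM YMY MY YM].
have E1 : M *m X = M *m Y.
  by rewrite -[LHS]MX -{1}MYM -(mulmxA _ M) trmx_mul MX MY mulmxA MXM.
have E2 : X *m M = Y *m M.
  rewrite -[LHS]XM -{1}MYM !mulmxA -(mulmxA _ Y) trmx_mul XM YM -mulmxA.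
  by rewrite (mulmxA M) MXM.
by rewrite -XMX -mulmxA E1 mulmxA E2 YMY.
Qed.

Lemma mpinvmxE m n (M : 'M[R]_(m, n)) X : penrose M X -> mpinvmx M = X.
Proof.
by move=> MX; apply: xget_unique => // Y MY; exact: penrose_unique MX.
Qed.

Lemma trmx_matfun n (M : 'M[R]_n) f : M^T = M -> (matfun f M)^T = matfun f M.
Proof.
move=> /matfun_diagonalization[U [mu [_ _ ->]]].
by rewrite !trmx_mul trmxK tr_diag_mx mulmxA.
Qed.

(** The Penrose equations become scalar identities such as [x * x^-1 * x = x], valid at [0] too
    thanks to the convention [0^-1 = 0]. *)
Lemma penrose_matfun n (M : 'M[R]_n) : M^T = M ->
  penrose M (matfun GRing.inv M).
Proof.
move=> symM; set X := matfun _ M.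
have MX : M *m X = matfun (fun x => x * x^-1) M by rewrite matfunM// matfun_id.
have XM : X *m M = matfun (fun x => x^-1 * x) M by rewrite matfunM// matfun_id.
split.
- rewrite MX -{2}(matfun_id symM) -matfunM// -[RHS](matfun_id symM).
  congr (matfun _ M); apply/funext => x.
  by have [->|x0] := eqVneq x 0; rewrite ?mulr0// mulfVK.
- rewrite XM -matfunM//; congr (matfun _ M); apply/funext => x.
  by have [->|x0] := eqVneq x 0; rewrite ?invr0 ?mulr0// mulVf// mul1r.
- by rewrite MX trmx_matfun.
- by rewrite XM trmx_matfun.
Qed.

Lemma matfun_scalar1 f (x : R) : matfun f (x%:M : 'M[R]_1) = (f x)%:M.
Proof.
have := @matfunE R f 1 1%:M (const_mx x).
rewrite /orthogonal_mx trmx1 !mul1mx !mulmx1 map_const_mx !diag_const_mx.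
exact.
Qed.

End matfun_theory.

(** * Entrywise measurability of matrix operations *)

Lemma measurable_invr (R : realType) : measurable_fun [set: R] (@GRing.inv R).
Proof.
have -> : [set: R] = [set 0] `|` ~` [set 0] by rewrite setUv.
apply/measurable_funU => //; first exact: measurableC.
split; first exact: measurable_fun_set1.
apply: open_continuous_measurable_fun.
  by rewrite openC; exact: closed_eq.
move=> x; rewrite inE => /eqP x0; exact: inv_continuous.
Qed.

Section measurable_mx.
Context d (T : measurableType d) (R : realType).

Definition measurable_mx m n (F : T -> 'M[R]_(m, n)) :=
  forall i j, measurable_fun [set: T] (fun w => F w i j).

Lemma measurable_mx_cst m n (A : 'M[R]_(m, n)) : measurable_mx (fun=> A).
Proof. by move=> i j; exact: measurable_cst. Qed.

Lemma measurable_mxD m n (F G : T -> 'M[R]_(m, n)) :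
  measurable_mx F -> measurable_mx G -> measurable_mx (fun w => F w + G w).
Proof.
by move=> mF mG i j; under eq_fun do rewrite mxE; exact: measurable_funD.
Qed.

Lemma measurable_mxB m n (F G : T -> 'M[R]_(m, n)) :
  measurable_mx F -> measurable_mx G -> measurable_mx (fun w => F w - G w).
Proof.
by move=> mF mG i j; under eq_fun do rewrite !mxE; exact: measurable_funB.
Qed.

Lemma measurable_mxM m n p (F : T -> 'M[R]_(m, n)) (G : T -> 'M[R]_(n, p)) :
  measurable_mx F -> measurable_mx G -> measurable_mx (fun w => F w *m G w).
Proof.
move=> mF mG i j; under eq_fun do rewrite mxE.
by apply: measurable_sum => k; exact: measurable_funM.
Qed.

Lemma measurable_trmx m n (F : T -> 'M[R]_(m, n)) :
  measurable_mx F -> measurable_mx (fun w => (F w)^T).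
Proof. by move=> mF i j; under eq_fun do rewrite mxE; exact: mF. Qed.

Lemma measurable_mxtrace n (F : T -> 'M[R]_n) :
  measurable_mx F -> measurable_fun [set: T] (fun w => \tr (F w)).
Proof. by move=> mF; apply: measurable_sum => i; exact: mF. Qed.

Lemma measurable_det n (F : T -> 'M[R]_n) :
  measurable_mx F -> measurable_fun [set: T] (fun w => \det (F w)).
Proof.
move=> mF; apply: measurable_sum => s.
by apply: measurable_funM => //; apply: measurable_prod => i _; exact: mF.
Qed.

Lemma measurable_invmx n (F : T -> 'M[R]_n) : (forall w, F w \in unitmx) ->
  measurable_mx F -> measurable_mx (fun w => invmx (F w)).
Proof.
move=> Fu mF i j.
(* Since every [F w] is invertible, [invmx] is the adjugate divided by the determinant, both
   polynomial in the entries. *)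
under eq_fun do rewrite /invmx Fu !mxE.
apply: measurable_funM.
  by apply: (measurableT_comp (@measurable_invr R)); exact: measurable_det.
apply: measurable_funM => //; apply: measurable_det.
by move=> a b; under eq_fun do rewrite !mxE; exact: mF.
Qed.

End measurable_mx.

(** * Borel functional calculus of a measurable symmetric matrix *)

Lemma cvg_power_ratio (R : realType) (p q : R) : 0 < q < p ->
  (fun j => p ^+ j / (p ^+ j + q ^+ j)) @ \oo --> (1 : R).
Proof.
move=> /andP[q0 qp]; have p0 : 0 < p by exact: lt_trans qp.
have qp1 : `|q / p| < 1.
  by rewrite ger0_norm ?divr_ge0 ?ltW// ltr_pdivrMr// mul1r.
have -> : (fun j => p ^+ j / (p ^+ j + q ^+ j)) = (fun j => (1 + (q / p) ^+ j)^-1).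
  apply/funext => j; rewrite expr_div_n; field.
  by rewrite !gt_eqF ?addr_gt0 ?exprn_gt0.
rewrite -[X in _ --> X]invr1; apply: cvgV; first exact: oner_neq0.
by rewrite -[X in _ --> X]addr0; apply: cvgD; [exact: cvg_cst|exact: cvg_expr].
Qed.

Section borel_matfun.
Context d (T : measurableType d) (R : realType) (n : nat) (M : T -> 'M[R]_n).
Hypothesis symM : forall w, (M w)^T = M w.
Hypothesis mM : measurable_mx M.

Let good (f : R -> R) := measurable_mx (fun w => matfun f (M w)).

Let good_id : good id.
Proof. by move=> i j; under eq_fun do rewrite matfun_id//; exact: mM. Qed.

Let good_cst c : good (fun=> c).
Proof.
by move=> i j; under eq_fun do rewrite matfun_cst//; exact: measurable_mx_cst.
Qed.

Let goodD f g : good f -> good g -> good (fun x => f x + g x).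
Proof.
move=> gf gg i j; under eq_fun do rewrite matfunD//.
exact: measurable_mxD.
Qed.

Let goodM f g : good f -> good g -> good (fun x => f x * g x).
Proof.
move=> gf gg i j; under eq_fun do rewrite matfunM//.
exact: measurable_mxM.
Qed.

Let goodX f k : good f -> good (fun x => f x ^+ k).
Proof.
move=> gf; elim: k => [|k IHk]; first exact: good_cst.
by under eq_fun do rewrite exprS; exact: goodM.
Qed.

Let goodV f : (forall x, f x != 0) -> good f -> good (fun x => (f x)^-1).
Proof.
move=> f0 gf i j; under eq_fun do rewrite matfunV//.
apply: measurable_invmx => // w.
(* Applying the calculus to [f * f^-1 = 1] exhibits an inverse of [matfun f (M w)]. *)
have /(congr1 (fun h => matfun h (M w))) : (fun x => f x * (f x)^-1) = (fun=> 1).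
  by apply/funext => x; rewrite mulfV.
by rewrite matfunM// matfun_cst// => /mulmx1_unit[].
Qed.

Let good_cvg (h : (R -> R)^nat) f : (forall m, good (h m)) ->
  (forall x, h ^~ x @ \oo --> f x) -> good f.
Proof.
move=> gh hf i j.
apply: (measurable_fun_cvg (h := fun m w => matfun (h m) (M w) i j)).
  by move=> m; exact: gh.
by move=> w _; exact: matfun_cvg.
Qed.

Let good_sum I (r : seq I) (h : I -> R -> R) : (forall i, good (h i)) ->
  good (fun x => \sum_(i <- r) h i x).
Proof.
move=> gh; elim: r => [|i r IHr].
  by under eq_fun do rewrite big_nil; exact: good_cst.
by under eq_fun do rewrite big_cons; exact: goodD.
Qed.

(* With [y = x - a], [p = 1 + (1 + y)^2] and [q = 1 + (1 - y)^2], the ratios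
   [p^j / (p^j + q^j)] converge to [1], [1/2] or [0] according to the sign of
   [y]; the polynomial [s (2 s - 1)] then sends [1/2] to [0]. *)
Let good_ray (a : R) : good \1_(`]a, +oo[%classic).
Proof.
pose s (x : R) : R := if a < x then 1 else if x == a then 2^-1 else 0.
have gs : good s.
  pose p (x : R) : R := 1 + (1 + (x + - a)) ^+ 2.
  pose q (x : R) : R := 1 + (1 + -1 * (x + - a)) ^+ 2.
  (* The summand [1] in [p] and [q] keeps them positive everywhere, so the denominators never vanish
     and [goodV] applies. *)
  have p0 x : 0 < p x by rewrite ltr_wpDr ?sqr_ge0.
  have q0 x : 0 < q x by rewrite ltr_wpDr ?sqr_ge0.
  have gp : good p.
    apply: goodD; first exact: good_cst.
    by apply: goodX; apply: goodD; [exact: good_cst|exact: goodD].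
  have gq : good q.
    apply: goodD; first exact: good_cst.
    apply: goodX; apply: goodD; first exact: good_cst.
    by apply: goodM; [exact: good_cst|exact: goodD].
  apply: (good_cvg (h := fun j x => p x ^+ j / (p x ^+ j + q x ^+ j))).
    move=> j; apply: goodM; first exact: goodX.
    apply: goodV; last by apply: goodD; exact: goodX.
    by move=> x; rewrite gt_eqF// addr_gt0// exprn_gt0.
  move=> x; rewrite /s; case: ltgtP => [ax|xa|<-].
  - by apply: cvg_power_ratio; rewrite q0/= /p /q; nra.
  (* Here [q x > p x]: the ratio is one minus the same ratio with [p] and [q] exchanged. *)
  - rewrite -[X in _ --> X](subrr 1).
    have -> : (fun j => p x ^+ j / (p x ^+ j + q x ^+ j)) =
        (fun j => 1 - q x ^+ j / (q x ^+ j + p x ^+ j)).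
      apply/funext => j; field.
      by rewrite !gt_eqF// addr_gt0// exprn_gt0.
    apply: cvgB; first exact: cvg_cst.
    by apply: cvg_power_ratio; rewrite p0/= /p /q; nra.
  - have -> : q a = p a by rewrite /p /q; ring.
    have -> : (fun j => p a ^+ j / (p a ^+ j + p a ^+ j)) = (fun=> 2^-1).
      by apply/funext => j; field; rewrite ?gt_eqF ?addr_gt0 ?exprn_gt0.
    exact: cvg_cst.
have -> : \1_(`]a, +oo[%classic) = (fun x => s x * (s x + (s x + -1))) :> (R -> R).
  apply/funext => x; rewrite indicE mem_setE in_itv/= andbT /s.
  by case: ltgtP => _ /=; field.
by apply: goodM => //; apply: goodD => //; exact: goodD.
Qed.

(** The sets with good indicator form a sigma-algebra containing the open rays, which generate the
    Borel sets. *)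
Let good_indic (S : set R) : measurable S -> good \1_S.
Proof.
pose G := [set S : set R | good \1_S].
suff : <<s @RGenOInfty.G R >> `<=` G.
  by move=> GS mS; apply: GS; rewrite -[X in X S]RGenOInfty.measurableE.
apply: smallest_sub; last by move=> _ [a ->]; exact: good_ray.
have G0 : G set0 by rewrite /G /= indic0; exact: good_cst.
have GC A : G A -> G (~` A).
  rewrite /G /= => GA.
  have -> : \1_(~` A) = (fun x => 1 + -1 * \1_A x) :> (R -> R).
    by apply/funext => x; rewrite !indicE in_setC; case: (x \in A) => /=; ring.
  by apply: goodD; [exact: good_cst|apply: goodM => //; exact: good_cst].
have GI A B : G A -> G B -> G (A `&` B).
  rewrite /G /= => GA GB.
  have -> : \1_(A `&` B) = (fun x => \1_A x * \1_B x) :> (R -> R).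
    by apply/funext => x; rewrite indicI.
  exact: goodM.
have GU A B : G A -> G B -> G (A `|` B).
  move=> GA GB; rewrite -[A `|` B]setCK setCU; apply: (GC).
  by apply: GI; exact: GC.
split => // [A GA|A GA]; first by rewrite setTD; exact: GC.
(* Indicators of the finite partial unions are eventually constant at each point, with limit the
   indicator of the countable union. *)
apply: (good_cvg (h := fun m => \1_(\big[setU/set0]_(i < m) A i))).
  by move=> m; apply: (big_ind G).
move=> x; have [[m _ Amx]|nAx] := pselect ((\bigcup_k A k) x); last first.
  rewrite indicE memNset//.
  have -> : (fun m => \1_(\big[setU/set0]_(i < m) A i) x) = (fun=> 0) :> (nat -> R).
    apply/funext => m; rewrite indicE memNset// -bigcup_mkord => -[k _ Akx].
    by apply: nAx; exists k.
  exact: cvg_cst.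
rewrite indicE mem_set; last by exists m.
apply: cvg_near_cst; near=> k; rewrite indicE mem_set// -bigcup_mkord.
by exists m => //=; near: k; exact: nbhs_infty_gt.
Unshelve. all: by end_near. Qed.

Lemma measurable_matfun (f : R -> R) : measurable_fun [set: R] f ->
  measurable_mx (fun w => matfun f (M w)).
Proof.
move=> mf.
have /(approximation_sfun measurableT)[h hf] :
  measurable_fun [set: R] (EFin \o f) by exact/measurable_EFinP.
rewrite -/(good f); apply: (good_cvg (h := fun m x => h m x)) => [m|x]; last first.
  by have /fine_cvgP[_] := hf x Logic.I.
(* Each approximating simple function is a finite linear combination of indicators of measurable
   sets. *)
under eq_fun do rewrite fimfunEord.
apply: good_sum => i; apply: goodM; first exact: good_cst.
by apply: good_indic; exact: measurable_sfunP.
Qed.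

End borel_matfun.

(** * Positivity and column invariance of the Nystrom approximation *)

Section nystrom_theory.
Variable R : realType.

Lemma trmx_congr n k (A : 'M[R]_n) (X : 'M[R]_(n, k)) :
  A^T = A -> (X^T *m A *m X)^T = X^T *m A *m X.
Proof. by move=> symA; rewrite !trmx_mul trmxK symA mulmxA. Qed.

Lemma psdmx_congr n k (A : 'M[R]_n) (X : 'M[R]_(n, k)) :
  psdmx A -> psdmx (X^T *m A *m X).
Proof.
move=> [symA A0]; split; first exact: trmx_congr.
by move=> x; have := A0 (X *m x); rewrite trmx_mul !mulmxA.
Qed.

Lemma psdmx_nystrom n k (A : 'M[R]_n) (X : 'M[R]_(n, k)) :
  psdmx A -> psdmx (nystrom A X).
Proof.
move=> psdA; have [symA _] := psdA.
have symM := trmx_congr X symA.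
have PM := penrose_matfun symM; have [_ XMX _ _] := PM.
(* Writing the pseudoinverse [Y] as [Y *m (X^T *m A *m X) *m Y] shows the approximation to be a
   congruence of [A] by [X *m Y *m X^T *m A]. *)
rewrite /nystrom (mpinvmxE PM) -[Y in _ *m Y *m _]XMX.
set Y := matfun _ _ in PM XMX *.
have YT : Y^T = Y by exact: trmx_matfun.
have := psdmx_congr (X *m Y *m X^T *m A) psdA.
by rewrite !trmx_mul YT symA trmxK !mulmxA.
Qed.

(* Right multiplication by an orthogonal [P] conjugates the pseudoinverse
   by [P], which then cancels. *)
Lemma nystrom_mulmxr n k (A : 'M[R]_n) (X : 'M[R]_(n, k)) (P : 'M[R]_k) :
  A^T = A -> orthogonal_mx P -> nystrom A (X *m P) = nystrom A X.
Proof.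
move=> symA oP; have oPT := orthogonal_mxC oP.
have symM := trmx_congr X symA.
have PM := penrose_matfun symM; rewrite /nystrom (mpinvmxE PM).
set M := X^T *m A *m X in symM PM *; set Y := matfun _ _ in PM *.
have -> : (X *m P)^T *m A *m (X *m P) = P^T *m M *m P.
  by rewrite trmx_mul /M !mulmxA.
rewrite (@mpinvmxE _ _ _ _ (P^T *m Y *m P)).
  rewrite !trmx_mul !mulmxA -(mulmxA _ P P^T) oPT mulmx1 -(mulmxA _ P P^T) oPT.
  by rewrite mulmx1.
have mulPP (B C : 'M[R]_k) :
    P^T *m B *m P *m (P^T *m C *m P) = P^T *m (B *m C) *m P.
  by rewrite !mulmxA -(mulmxA _ P P^T) oPT mulmx1.
case: PM => MYM YMY MY YM; split; rewrite !mulPP ?MYM ?YMY//.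
  exact: trmx_congr.
exact: trmx_congr.
Qed.

Lemma nystrom_col_perm n k (A : 'M[R]_n) (X : 'M[R]_(n, k)) (s : 'S_k) :
  A^T = A -> nystrom A (col_perm s X) = nystrom A X.
Proof.
move=> symA; rewrite col_permE nystrom_mulmxr// /orthogonal_mx.
by rewrite tr_perm_mx -perm_mxM mulVg perm_mx1.
Qed.

End nystrom_theory.

(** * Permuting columns versus removing one *)

Lemma perm_lift k (s : 'S_k.+1) (i : 'I_k.+1) :
  exists t : 'S_k, forall j, lift (s i) (t j) = s (lift i j).
Proof.
have si_neq j : s i != s (lift i j) by rewrite (inj_eq perm_inj) neq_lift.
(* As [s] maps the indices other than [i] to those other than [s i], [g] is that bijection after
   renumbering both sides by [lift]. *)
pose g j := s2val (unlift_some (si_neq j)).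
have gE j : lift (s i) (g j) = s (lift i j).
  by rewrite /g; case: unlift_some.
have g_inj : injective g.
  by move=> a b /(congr1 (lift (s i))); rewrite !gE => /perm_inj/lift_inj.
by exists (perm g_inj) => j; rewrite permE gE.
Qed.

Lemma col'_col_perm (R : Type) n k (X : 'M[R]_(n, k)) (s : 'S_k) (i : 'I_k) :
  exists t : 'S_k.-1, col' i (col_perm s X) = col_perm t (col' (s i) X).
Proof.
case: k X s i => [|k] X s i; first by case: i.
have [t tE] := perm_lift s i; exists t.
by apply/matrixP => a b; rewrite !mxE tE.
Qed.

Lemma colsmx_perm (R : realType) n k (s : 'S_k) (w : k.-tuple (n.-tuple R)) :
  colsmx [tuple tnth w (s i) | i < k] = col_perm s (colsmx w).
Proof. by apply/matrixP => i j; rewrite !mxE tnth_mktuple. Qed.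

(** * Scalar properties of operator monotone functions *)

Section opmonotone_theory.
Variables (R : realType) (f : R -> R).
Hypothesis opf : opmonotone f.

Lemma opmonotone_nondecreasing (x y : R) : 0 <= x <= y -> f x <= f y.
Proof.
move=> /andP[x0 xy]; have y0 := le_trans x0 xy.
have psd1 (z : R) : psdmx (z%:M : 'M[R]_1) <-> 0 <= z.
  split=> [[_ /(_ 1%:M)]|z0].
    by rewrite trmx1 mul1mx mulmx1 mxE eqxx mulr1n.
  split=> [|v]; first by rewrite tr_scalar_mx.
  rewrite mul_mx_scalar -scalemxAl mxE mulr_ge0//.
  exact: trmx_mul_self_ge0.
case: opf => _ _ /(_ 1%N x%:M y%:M) mono.
rewrite -subr_ge0; apply/psd1.
rewrite raddfB /= -!(matfun_scalar1 f); apply: mono; [exact/psd1|exact/psd1|].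
by rewrite /loewner_le -raddfB /=; apply/psd1; rewrite subr_ge0.
Qed.

(** The values of [f] on negative numbers are arbitrary; replacing them by [0] gives a function
    nondecreasing on all of [R], because [f] is nonnegative on the half-line. *)
Lemma measurable_opmonotone_restrict :
  measurable_fun [set: R] (fun x => if 0 <= x then f x else 0).
Proof.
apply: nondecreasing_measurable => // x y xy /=.
case: ifPn => x0.
  by rewrite (le_trans x0 xy) opmonotone_nondecreasing// x0.
by case: ifPn => // y0; case: opf => /(_ y y0).
Qed.

End opmonotone_theory.

(** * Measurability of the Nystrom approximation and of its image under [f] *)

Section measurable_flextrace.
Context d (T : measurableType d) (R : realType).

Lemma measurable_matfun_opmonotone n (M : T -> 'M[R]_n) (f : R -> R) :
  opmonotone f -> (forall w, psdmx (M w)) -> measurable_mx M ->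
  measurable_mx (fun w => matfun f (M w)).
Proof.
move=> opf psdM mM.
have -> : (fun w => matfun f (M w)) =
    (fun w => matfun (fun x => if 0 <= x then f x else 0) (M w)).
  apply/funext => w; apply: psdmx_matfun_eq => // x.
  by rewrite nnegrE => ->.
apply: measurable_matfun => // [w|]; first by have [] := psdM w.
exact: measurable_opmonotone_restrict.
Qed.

Lemma measurable_nystrom n k (A : 'M[R]_n) (X : T -> 'M[R]_(n, k)) :
  A^T = A -> measurable_mx X -> measurable_mx (fun w => nystrom A (X w)).
Proof.
move=> symA mX.
have mAX : measurable_mx (fun w => A *m X w).
  by apply: measurable_mxM => //; exact: measurable_mx_cst.
(* The pseudoinverse is discontinuous where the rank drops, but as [matfun GRing.inv] it falls under
   the Borel calculus. *)
have -> : (fun w => nystrom A (X w)) = (fun w => A *m X w *m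
    matfun GRing.inv ((X w)^T *m A *m X w) *m (A *m X w)^T).
  apply/funext => w; congr (_ *m _ *m _); apply: mpinvmxE.
  exact/penrose_matfun/trmx_congr.
apply: measurable_mxM; last exact: measurable_trmx.
apply: measurable_mxM => //; apply: measurable_matfun.
- by move=> w; exact: trmx_congr.
- apply: measurable_mxM => //; apply: measurable_mxM.
    exact: measurable_trmx.
  exact: measurable_mx_cst.
- exact: measurable_invr.
Qed.

End measurable_flextrace.

Theorem theorem3p1 (R : realType) (n k : nat) (A : 'M[R]_n) (f : R -> R)
    (hA : psdmx A) (hf : opmonotone f) (hk1 : (1 <= k)%N) (hkn : (k <= n)%N) :
  exchangeable (@flextrace R n k A f).
Proof.
have symA : A^T = A by case: hA.
split; last first.
  move=> s w; rewrite /flextrace colsmx_perm nystrom_col_perm//; congr (_ * _).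
  (* Reindexing the sum for [w] sets its term [s i] against term [i] for the permuted tuple; the two
     reduced test matrices differ by a column permutation [t]. *)
  rewrite (reindex_inj (@perm_inj _ s)); apply: eq_bigr => i _ /=.
  have [t ->] := col'_col_perm (colsmx w) s i; rewrite nystrom_col_perm//.
  suff -> : col i (col_perm s (colsmx w)) = col (s i) (colsmx w) by [].
  by apply/matrixP => a b; rewrite !mxE.
have mcols : measurable_mx (@colsmx R n k).
  move=> i j; under eq_fun do rewrite mxE.
  exact: (measurableT_comp (measurable_tnth i) (measurable_tnth j)).
(* The width [m] is left free so as to cover both the full test matrix and those with one column
   removed. *)
have mf m (X : k.-tuple (n.-tuple R) -> 'M[R]_(n, m)) :
    measurable_mx X -> measurable_mx (fun w => matfun f (nystrom A (X w))).
  move=> mX; apply: measurable_matfun_opmonotone => //.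
    by move=> w; exact: psdmx_nystrom.
  exact: measurable_nystrom.
rewrite /flextrace; apply: measurable_funM => //.
apply: measurable_sum => i.
have mcol' : measurable_mx (fun w : k.-tuple (n.-tuple R) => col' i (colsmx w)).
  by move=> a b; under eq_fun do rewrite mxE; exact: mcols.
have mcol : measurable_mx (fun w : k.-tuple (n.-tuple R) => col i (colsmx w)).
  by move=> a b; under eq_fun do rewrite mxE; exact: mcols.
apply: measurable_funD; first by apply: measurable_mxtrace; exact: mf.
apply: (measurable_mxM _ mcol); apply: measurable_mxM.
  exact: measurable_trmx.
by apply: measurable_mxB; exact: mf.
Qed.
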